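(* Let $(X,\mathscr B,m)$ be a probability space and let $P:L^1(m)\to L^1(m)$ be a Markov operator. The following assertions are equivalent: (1) there exists an invariant density for $P$; (2) there exist $\alpha\in(0,1)$ and $\delta>0$ such that $$\sup_{n\ge0}\int_AP^n1_X\,dm<\alpha\quad\text{for any }A\in\mathscr B\text{ with }m(A)<\delta;$$ (3) there exist $\alpha\in(0,1)$ and $\delta>0$ such that $$\sup_{n\ge1}\int_AA_n1_X\,dm<\alpha\quad\text{for any }A\in\mathscr B\text{ with }m(A)<\delta.$$ Moreover, the equivalence of (1), (2) and (3) also holds by taking $\alpha=1$ (instead of some $\alpha\in(0,1)$) in both (2) and (3).
   Context: A Markov operator on $L^1(m)$ is a linear positive operator $P$ with $\int P\varphi\,dm=\int\varphi\,dm$ for all $\varphi\in L^1(m)$. $A_n=\frac1n\sum_{i=0}^{n-1}P^i$. An invariant density for $P$ is $h\in L^1(m)$ with $h\ge0$ $m$-a.e., $\int h\,dm=1$ and $Ph=h$. *)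

(* Defs.v *)
From HB Require Import structures.
From mathcomp Require Import all_boot all_order all_algebra.
From mathcomp Require Import all_classical all_reals all_analysis.
From mathcomp Require Import measurable_realfun ess_sup_inf.

Set Implicit Arguments.
Unset Strict Implicit.
Unset Printing Implicit Defensive.
Import Order.TTheory GRing.Theory Num.Theory.
Import numFieldNormedType.Exports.

Local Open Scope classical_set_scope.
Local Open Scope ring_scope.

Lemma filterS4 (I : Type) (F : set_system I) (FF : Filter F)
    (P1 P2 P3 P4 Q : set I) :
  (forall x, P1 x -> P2 x -> P3 x -> P4 x -> Q x) ->
  F P1 -> F P2 -> F P3 -> F P4 -> F Q.
Proof. by move=> H h1 h2 h3; apply: filter_app; apply: filterS3 h1 h2 h3. Qed.

(* The library defines the quotient type [LspaceType mu p1] but equips it with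
   no algebraic structure. The vector space structure is transported here from
   that of [LfunType mu p1] through representatives; the lemmas ending in [_ae]
   characterize it by the pointwise operations, almost everywhere. *)
Section Lspace_lmodule.
Context d (T : measurableType d) (R : realType).
Variables (mu : {measure set T -> \bar R}) (p : \bar R) (p1 : (1 <= p)%E).
Local Notation Lp := (LspaceType mu p1).
Local Notation Lf := (LfunType mu p1).
Implicit Types (f g h : Lp) (u v : Lf) (a b : R).

(* [LspaceType] is built on [measurableTypeR R], whose sigma-algebra is
   convertible to, but syntactically different from, the one inferred for [R];
   [toRM] moves from one to the other. *)
Local Notation RM := (measurableTypeR R).
Local Notation Q := {mfun_ mu, T >-> measurableTypeR R}.

Let mfunRM u : measurable_fun [set: T] (u : T -> RM).
Proof. by have := measurable_funPT u. Qed.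
Let toRM u : {mfun T >-> RM} :=
  HB.pack (u : T -> RM) (@isMeasurableFun.Build _ _ _ _ (u : T -> RM) (mfunRM u)).
Let piQ u : Q := \pi_Q%qT (toRM u).

Lemma repr_pi_ae u : (piQ u : T -> R) = u %[ae mu].
Proof.
have /eqP : \pi_Q%qT (repr (piQ u)) = \pi_Q%qT (toRM u) by rewrite reprK.
by rewrite eqmodE => /asboolP.
Qed.

Let mfunQ (f : Q) : measurable_fun [set: T] (f : T -> R).
Proof. by have := measurable_funPT (repr f). Qed.

Lemma ae_finite_norm (u v : T -> R) :
  measurable_fun setT u -> measurable_fun setT v ->
  u = v %[ae mu] -> finite_norm mu p u -> finite_norm mu p v.
Proof.
rewrite /finite_norm => mu_ mv uv.
suff -> : 'N[mu]_p[EFin \o u]%E = 'N[mu]_p[EFin \o v]%E by [].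
rewrite unlock /Lnorm; move: p1; case: p => [r|_|]//.
- have mX (w : T -> R) : measurable_fun setT w ->
      measurable_fun setT (fun x => `|(w x)%:E| `^ r)%E.
    move=> mw.
    have mN : measurable_fun setT (fun x => `|(w x)%:E|)%E.
      by apply: measurableT_comp => //; exact/measurable_EFinP.
    exact: measurableT_comp (measurable_poweR r) mN.
  move=> _; congr (_ `^ _)%E; apply: ae_eq_integral => //; [exact: mX..|].
  by apply: filterS uv => x /= /[swap] _ /(_ I) ->.
- case: ifP => // _; apply: eq_ess_sup.
  by apply: filterS uv => x /= /(_ I) ->.
Qed.

Lemma finite_norm_pi u : finite_norm mu p (piQ u).
Proof.
apply: (@ae_finite_norm u) => //; exact/ae_eq_sym/repr_pi_ae.
Qed.

(* [Lclass u] is the class of [u] modulo a.e. equality, [Lrepr f] the chosen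
   representative of [f]. *)
Definition Lclass u : Lp := HB.pack (piQ u)
  (@isFinLebesgue.Build _ _ _ mu p p1 (piQ u) (finite_norm_pi u)).

Lemma Lspace_Lfun f : (f : T -> R) \in Lfun mu p.
Proof.
apply/andP; split; rewrite inE/=; first exact: mfunQ.
exact: Lebesgue_finite.
Qed.

Definition Lrepr f : Lf := Lfun_Sub p1 (Lspace_Lfun f).

Lemma LspaceP f g : f = g <-> f = g %[ae mu].
Proof.
split=> [->|]; first exact: ae_eq_refl.
case: f g => [f [[cf]]] [g [[cg]]] /= fg.
have E : f = g by apply/eqP; rewrite -[f]reprK -[g]reprK eqmodE; exact/asboolP.
by subst g; rewrite (Prop_irrelevance cf cg).
Qed.

Lemma LclassK u : Lclass u = u %[ae mu].
Proof. exact: repr_pi_ae. Qed.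

Lemma LreprE f : Lrepr f = f :> (T -> R).
Proof. by []. Qed.

HB.instance Definition _ := gen_eqMixin Lp.
HB.instance Definition _ := gen_choiceMixin Lp.

Definition Lspace_add f g : Lp := Lclass (Lrepr f + Lrepr g).
Definition Lspace_opp f : Lp := Lclass (- Lrepr f).
Definition Lspace_scale a f : Lp := Lclass (a *: Lrepr f).

Let add_ae f g : Lspace_add f g = (f : T -> R) \+ (g : T -> R) %[ae mu].
Proof. exact: LclassK. Qed.
Let opp_ae f : Lspace_opp f = \- (f : T -> R) %[ae mu].
Proof. exact: LclassK. Qed.
Let zero_ae : Lclass 0 = (fun=> 0) %[ae mu].
Proof. exact: LclassK. Qed.
Let scale_ae a f : Lspace_scale a f = a \*: (f : T -> R) %[ae mu].
Proof. exact: LclassK. Qed.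

Let addA : associative Lspace_add.
Proof.
move=> f g h; apply/LspaceP.
have := add_ae f (Lspace_add g h); have := add_ae g h.
have := add_ae (Lspace_add f g) h; have := add_ae f g.
apply: filterS4 => x /= h1 h2 h3 h4 _.
by rewrite h4// h3// h2// h1// addrA.
Qed.

Let addC : commutative Lspace_add.
Proof.
move=> f g; apply/LspaceP; have := add_ae f g; have := add_ae g f.
by apply: filterS2 => x /= h1 h2 _; rewrite h1// h2// addrC.
Qed.

Let add0 : left_id (Lclass 0) Lspace_add.
Proof.
move=> f; apply/LspaceP; have := add_ae (Lclass 0) f; have := zero_ae.
by apply: filterS2 => x /= h1 h2 _; rewrite h2// h1// add0r.
Qed.

Let addN : left_inverse (Lclass 0) Lspace_opp Lspace_add.
Proof.
move=> f; apply/LspaceP; have := add_ae (Lspace_opp f) f.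
have := opp_ae f; have := zero_ae.
by apply: filterS3 => x /= h1 h2 h3 _; rewrite h3// h2// h1// addNr.
Qed.

HB.instance Definition _ := GRing.isZmodule.Build Lp addA addC add0 addN.

Let scaleA a b f : Lspace_scale a (Lspace_scale b f) = Lspace_scale (a * b) f.
Proof.
apply/LspaceP; have := scale_ae a (Lspace_scale b f).
have := scale_ae b f; have := scale_ae (a * b) f.
by apply: filterS3 => x /= h1 h2 h3 _; rewrite h3// h2// h1// scalerA.
Qed.

Let scale1 : left_id 1 Lspace_scale.
Proof.
move=> f; apply/LspaceP; have := scale_ae 1 f.
by apply: filterS => x /= h1 _; rewrite h1// scale1r.
Qed.

Let scaleDr : right_distributive Lspace_scale +%R.
Proof.
move=> a f g; apply/LspaceP; have := scale_ae a (f + g); have := add_ae f g.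
have := add_ae (Lspace_scale a f) (Lspace_scale a g).
have := scale_ae a g; have := scale_ae a f.
move=> e1 e2 e3 e4; apply: filter_app; move: e1 e2 e3 e4.
apply: filterS4 => x /= h1 h2 h3 h4 h5 _.
by rewrite h5// h3// h2// h1// h4// scalerDr.
Qed.

Let scaleDl f : {morph Lspace_scale^~ f : a b / a + b}.
Proof.
move=> a b; apply/LspaceP; have := scale_ae (a + b) f.
have := add_ae (Lspace_scale a f) (Lspace_scale b f).
have := scale_ae a f; have := scale_ae b f.
by apply: filterS4 => x /= h1 h2 h3 h4 _; rewrite h4// h3// h2// h1// scalerDl.
Qed.

HB.instance Definition _ := GRing.Zmodule_isLmodule.Build R Lp
  scaleA scale1 scaleDr scaleDl.

Lemma LspaceD_ae f g : (f + g)%R = (f : T -> R) \+ (g : T -> R) %[ae mu].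
Proof. exact: add_ae. Qed.

Lemma LspaceN_ae f : (- f)%R = \- (f : T -> R) %[ae mu].
Proof. exact: opp_ae. Qed.

Lemma Lspace0_ae : (0 : Lp) = (fun=> 0) %[ae mu].
Proof. exact: zero_ae. Qed.

Lemma LspaceZ_ae a f : (a *: f)%R = a \*: (f : T -> R) %[ae mu].
Proof. exact: scale_ae. Qed.

End Lspace_lmodule.

Section markov_operator.
Context d (T : measurableType d) (R : realType) (m : probability T R).
Local Notation L1 := (LspaceType1 m).
Local Open Scope ereal_scope.

Record markov_operator (P : {linear L1 -> L1}) : Prop := {
  markov_positive : forall f : L1,
    (\forall x \ae m, (0 <= f x)%R) -> \forall x \ae m, (0 <= P f x)%R ;
  markov_integral : forall f : L1,
    \int[m]_x (P f x)%:E = \int[m]_x (f x)%:E }.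

Definition invariant_density (P : {linear L1 -> L1}) (h : L1) : Prop :=
  [/\ \forall x \ae m, (0 <= h x)%R, \int[m]_x (h x)%:E = 1 & P h = h].

Definition cesaro (P : {linear L1 -> L1}) (n : nat) (f : L1) : L1 :=
  (n%:R^-1 *: \sum_(0 <= i < n) iter i P f)%R.

Lemma indicT_Lfun : (\1_[set: T] : T -> R) \in Lfun m 1.
Proof. by rewrite indicT; exact: Lfun_cst. Qed.

Definition L1_indicT : L1 := Lclass (Lfun_Sub (lexx 1) indicT_Lfun).

Lemma L1_indicT_ae : L1_indicT = \1_[set: T] %[ae m].
Proof. exact: LclassK. Qed.

Definition sup_powers (P : {linear L1 -> L1}) (A : set T) : \bar R :=
  ereal_sup [set (\int[m]_(x in A) (iter n P L1_indicT x)%:E)%E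
            | n in [set: nat]].

Definition sup_averages (P : {linear L1 -> L1}) (A : set T) : \bar R :=
  ereal_sup [set (\int[m]_(x in A) (cesaro P n L1_indicT x)%:E)%E
            | n in [set n | (1 <= n)%N]].

End markov_operator.

(* Main.v *)
Require Import Defs.
From HB Require Import structures.
From mathcomp Require Import all_boot all_order all_algebra.
From mathcomp Require Import all_classical all_reals all_analysis.
From mathcomp Require Import measurable_realfun.
From mathcomp Require Import ring lra.

Set Implicit Arguments.
Unset Strict Implicit.
Unset Printing Implicit Defensive.
Import Order.TTheory GRing.Theory Num.Theory.
Import numFieldNormedType.Exports.

Local Open Scope classical_set_scope.
Local Open Scope ring_scope.

(** The substance of the theorem is that the weakest condition, averages leaving
    some mass outside every set of measure less than [delta], produces an
    invariant density. The averages [A_n 1] are almost invariant, because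
    [P (A_n 1) - A_n 1 = (P^n 1 - 1) / n], but they need not converge. Passing to
    suitable convex combinations of averages of higher and higher order makes
    them converge almost everywhere, and neither duality nor Banach limits are
    needed afterwards.

    Only a few convex conditions on such a combination [v] matter: [v >= 0],
    [\int v = 1], [P v - v] has small [L^1] norm, and the integral of [v] over any
    set [A] is at most the supremum of those of the averages. Let [C e] be the
    set of [v] that satisfy them with [\int |P v - v| <= e]. It shrinks with [e]
    and is stable under midpoints, so the strict convexity of
    [v |-> \int 1 / (1 + v)] gives a sequence of almost minimizers [v k] in
    [C (2 ^- k)] for which [1 / (1 + v k)] converges almost everywhere
    ([ae_cvg_in_decreasing_midconvex]); by Fatou's lemma [v k] then has a finite
    limit [h]. Positivity of [P] turns this into [P h <= h], and preservation of
    the integral into [P h = h] ([markov_fixed_of_ae_limit]).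

    It remains to exclude [h = 0]. If it held, Egorov's theorem would make
    [v k] tend to [0] uniformly off some set [B] of measure less than [delta], so
    that the integral of [v k] over [B] would tend to [1]; but it is at most
    [sup_averages P B < 1]. Normalizing [h] gives [invariant_density_of_averages].

    Conversely, when [h] is an invariant density, [P^n 1 >= P^n (min h K) / K],
    while [P^n (min h K)] keeps the mass of [min h K] and lies below [h], whose
    integral over small sets is small; hence a fixed part of the mass of [P^n 1]
    lies outside every small set ([sup_powers_of_invariant_density]). Bounds for
    the powers pass to the averages. *)

(** * Integrals of almost everywhere ordered functions *)

Section almost_everywhere_integrals.
Context d (T : measurableType d) (R : realType).
Variable mu : {measure set T -> \bar R}.
Implicit Types (D : set T) (f g h : T -> R).

Lemma integrable_measurable f :
  mu.-integrable setT (EFin \o f) -> measurable_fun setT f.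
Proof. by move=> /measurable_int /measurable_EFinP. Qed.

Lemma integrable_setS D f : measurable D ->
  mu.-integrable setT (EFin \o f) -> mu.-integrable D (EFin \o f).
Proof. by move=> mD; apply: integrableS. Qed.

Lemma EFin_Rintegral D f : measurable D ->
  mu.-integrable setT (EFin \o f) ->
  (\int[mu]_(x in D) f x)%:E = (\int[mu]_(x in D) (f x)%:E)%E.
Proof.
by move=> mD if_; rewrite fineK//; apply: integrable_fin_num => //;
  exact: integrable_setS.
Qed.

Lemma ae_eq_Rintegral D f g : measurable D ->
  measurable_fun setT f -> measurable_fun setT g ->
  f = g %[ae mu] -> \int[mu]_(x in D) f x = \int[mu]_(x in D) g x.
Proof.
move=> mD mf mg fg; congr fine; apply: ae_eq_integral => //.
- by apply/measurable_EFinP; exact: measurable_funTS.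
- by apply/measurable_EFinP; exact: measurable_funTS.
- by apply: filterS fg => x /= /(_ I) ->.
Qed.

Lemma ae_eq_integrable f g : measurable_fun setT g ->
  f = g %[ae mu] -> mu.-integrable setT (EFin \o f) ->
  mu.-integrable setT (EFin \o g).
Proof.
move=> mg fg if_; have mf := integrable_measurable if_.
apply/integrableP; split; first exact/measurable_EFinP.
move/integrableP : if_ => [_]; apply: le_lt_trans.
rewrite le_eqVlt; apply/orP; left; apply/eqP.
apply: ae_eq_integral => //.
- by apply: measurableT_comp => //; exact/measurable_EFinP.
- by apply: measurableT_comp => //; exact/measurable_EFinP.
- by apply: filterS fg => x /= /(_ I) ->.
Qed.

Lemma le_integrable_real f g : measurable_fun setT f ->
  (forall x, `|f x| <= g x) -> mu.-integrable setT (EFin \o g) ->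
  mu.-integrable setT (EFin \o f).
Proof.
move=> mf fg ig; apply: (le_integrable _ _ _ ig) => //.
  exact/measurable_EFinP.
by move=> x _; rewrite /= lee_fin (le_trans (fg x))// ler_norm.
Qed.

Lemma integrable_minr f g : mu.-integrable setT (EFin \o f) ->
  mu.-integrable setT (EFin \o g) ->
  mu.-integrable setT (EFin \o (fun x => Num.min (f x) (g x))).
Proof.
move=> if_ ig.
apply: (@le_integrable_real _ (fun x => `|f x| + `|g x|)).
- by apply: measurable_minr; exact: integrable_measurable.
- move=> x; have := normr_ge0 (f x); have := normr_ge0 (g x).
  by rewrite /Num.min; case: ifP => _ ? ?; lra.
- have := integrableD measurableT (integrable_norm if_) (integrable_norm ig).
  by apply: eq_integrable => // x _ /=; rewrite EFinD.
Qed.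

Lemma ae_le_Rintegral D f g : measurable D ->
  mu.-integrable setT (EFin \o f) -> mu.-integrable setT (EFin \o g) ->
  (\forall x \ae mu, f x <= g x) ->
  \int[mu]_(x in D) f x <= \int[mu]_(x in D) g x.
Proof.
move=> mD if_ ig fg; have im := integrable_minr if_ ig.
have -> : \int[mu]_(x in D) f x = \int[mu]_(x in D) Num.min (f x) (g x).
  apply: ae_eq_Rintegral => //; [exact: integrable_measurable..|].
  by apply: filterS fg => x fgx _; rewrite min_l.
apply: le_Rintegral => //; [exact: integrable_setS..|].
by move=> x _; rewrite ge_min lexx orbT.
Qed.

Lemma ae_Rintegral_ge0 D f : measurable D ->
  mu.-integrable setT (EFin \o f) -> (\forall x \ae mu, 0 <= f x) ->
  0 <= \int[mu]_(x in D) f x.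
Proof.
move=> mD if_ f0.
have -> : \int[mu]_(x in D) f x = \int[mu]_(x in D) `|f x|.
  have mf := integrable_measurable if_.
  apply: ae_eq_Rintegral => //; first exact: measurableT_comp.
  by apply: filterS f0 => x fx0 _; rewrite ger0_norm.
exact: Rintegral_ge0.
Qed.

Lemma Rintegral_le0_ae0 f : mu.-integrable setT (EFin \o f) ->
  (\forall x \ae mu, 0 <= f x) -> \int[mu]_x f x <= 0 ->
  f = (fun=> 0) %[ae mu].
Proof.
move=> if_ f0 If0.
have If : (\int[mu]_x `|f x| = 0)%R.
  have mf := integrable_measurable if_.
  rewrite -(@ae_eq_Rintegral _ f)//; last 2 first.
  - exact: measurableT_comp.
  - by apply: filterS f0 => x fx0 _; rewrite ger0_norm.
  by apply/eqP; rewrite eq_le If0 ae_Rintegral_ge0.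
have : (\int[mu]_x `|(f x)%:E| = 0)%E.
  by rewrite -[LHS](EFin_Rintegral measurableT (integrable_norm if_)) If.
move/ae_eq_integral_abs => /(_ measurableT).
have /integrableP[mf _] := if_.
by move=> /(_ mf); apply: filterS => x /= /(_ I) [].
Qed.

Lemma dominated_cvg_Rintegral (f_ : nat -> T -> R) f g :
  (forall n, measurable_fun setT (f_ n)) -> measurable_fun setT f ->
  (\forall x \ae mu, f_ ^~ x @ \oo --> f x) ->
  mu.-integrable setT (EFin \o g) ->
  (\forall x \ae mu, forall n, `|f_ n x| <= g x) ->
  mu.-integrable setT (EFin \o f) /\
  (fun n => \int[mu]_x f_ n x) @ \oo --> \int[mu]_x f x.
Proof.
move=> mf_ mf ff ig fg.
have [|||||intf _ cvf] := @dominated_convergence _ _ _ mu setT measurableT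
  (fun n => EFin \o f_ n) (EFin \o f) (EFin \o g).
- by move=> n; exact/measurable_EFinP.
- exact/measurable_EFinP.
- by apply: filterS ff => x fx _ /=; apply: cvg_EFin => //; exact: nearW.
- by [].
- by apply: filterS fg => x fgx n _ /=; rewrite lee_fin.
split=> //; apply: fine_cvg.
by rewrite EFin_Rintegral.
Qed.

(** The sum of the absolute values has a finite integral, hence is finite almost
    everywhere. *)
Lemma ae_cvg_series_of_summable (f_ : nat -> T -> R) :
  (forall n, measurable_fun setT (f_ n)) ->
  (\sum_(n <oo) \int[mu]_x `|(f_ n x)%:E| < +oo)%E ->
  \forall x \ae mu, cvgn (series (f_ ^~ x)).
Proof.
move=> mf_ sf.
have mN n : measurable_fun setT (fun x => `|(f_ n x)%:E|)%E.
  by apply: measurableT_comp => //; exact/measurable_EFinP.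
have iS : mu.-integrable setT (fun x => \sum_(n <oo) `|(f_ n x)%:E|)%E.
  apply/integrableP; split.
    by apply: ge0_emeasurable_sum => //.
  under eq_integral do rewrite gee0_abs ?nneseries_ge0//.
  by rewrite integral_nneseries.
have := integrable_ae measurableT iS; apply: filterS => x /= /(_ I) fin.
apply: normed_cvg => /=.
apply: nondecreasing_is_cvgn.
  by apply: nondecreasing_series => n _ _ /=.
exists (fine (\sum_(n <oo) `|(f_ n x)%:E|)%E) => _ [n _ <-].
rewrite -lee_fin fineK// /series/= -sumEFin.
exact: nneseries_lim_ge.
Qed.

End almost_everywhere_integrals.

(** * Almost everywhere convergence in decreasing convex sets *)

Section forward_convexity.
Context d (T : measurableType d) (R : realType) (mu : probability T R).
Implicit Types f g v w : T -> R.

Lemma Rintegral_probability_cst (r : R) : \int[mu]_x r = r.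
Proof.
rewrite Rintegral_cst// -[RHS]mulr1; congr (_ * _).
exact: (congr1 fine (probability_setT mu)).
Qed.

(** A bounded, strictly convex, decreasing function of [`|a|], so that its
    integral can be minimized without any bound on the functions. *)
Let shrink (a : R) : R := (1 + `|a|)^-1.

Lemma shrink_gt0 (a : R) : 0 < shrink a.
Proof. by rewrite invr_gt0 ltr_pwDl. Qed.

Lemma shrink_le1 (a : R) : shrink a <= 1.
Proof. by rewrite invf_le1 ?lerDl// ltr_pwDl. Qed.

Lemma measurable_shrink f : measurable_fun setT f ->
  measurable_fun setT (shrink \o f).
Proof.
move=> mf; apply: measurableT_comp => //; apply: continuous_measurable_fun => a.
apply: cvgV; first by rewrite gt_eqF// ltr_pwDl.
by apply: cvgD; [exact: cvg_cst|exact: norm_continuous].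
Qed.

Lemma integrable_bounded f (M : R) : measurable_fun setT f ->
  (forall x, `|f x| <= M) -> mu.-integrable setT (EFin \o f).
Proof.
move=> mf fM; apply: (@le_integrable_real _ _ _ _ _ (cst M)) => //.
exact: finite_measure_integrable_cst.
Qed.

Lemma integrable_shrink f : measurable_fun setT f ->
  mu.-integrable setT (EFin \o (shrink \o f)).
Proof.
move=> mf; apply: (@integrable_bounded _ 1); first exact: measurable_shrink.
by move=> x; rewrite /= gtr0_norm ?shrink_gt0// shrink_le1.
Qed.

(** Convexity is uniform when distances are measured between the values of
    [shrink], although it degenerates for large arguments. In terms of [p = 1 + a]
    and [q = 1 + b], the right-hand side is [2 (p - q)^2 / (p q (p + q))] and the
    left-hand side [(p - q)^2 / (p q)^2], so that the claim is [p + q <= 2 p q],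
    true when [p] and [q] are at least [1]. *)
Lemma shrink_midpoint (a b : R) : 0 <= a -> 0 <= b ->
  (shrink a - shrink b) ^+ 2 <=
  2 * (shrink a + shrink b - 2 * shrink ((a + b) / 2)).
Proof.
move=> a0 b0; rewrite /shrink !ger0_norm ?divr_ge0 ?addr_ge0//.
set p := 1 + a; set q := 1 + b.
have p1 : 1 <= p by rewrite lerDl.
have q1 : 1 <= q by rewrite lerDl.
have -> : 1 + (a + b) / 2 = (p + q) / 2 by rewrite /p /q; field.
have p0 : p != 0 by rewrite gt_eqF// (lt_le_trans ltr01).
have q0 : q != 0 by rewrite gt_eqF// (lt_le_trans ltr01).
have pq0 : p + q != 0 by rewrite gt_eqF// addr_gt0// (lt_le_trans ltr01).
rewrite -subr_ge0.
have -> : 2 * (p^-1 + q^-1 - 2 * ((p + q) / 2)^-1) - (p^-1 - q^-1) ^+ 2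
   = (p - q) ^+ 2 * (2 * p * q - (p + q)) / (p ^+ 2 * q ^+ 2 * (p + q)).
  by field; rewrite p0 q0 pq0.
apply: divr_ge0; last by rewrite !mulr_ge0 ?sqr_ge0 ?addr_ge0; lra.
by apply: mulr_ge0; [exact: sqr_ge0|nra].
Qed.

Lemma normr_le_sqr_weight (x t : R) : 0 < t ->
  `|x| <= (t^-1 * x ^+ 2 + t) / 2.
Proof.
move=> t0; rewrite ler_pdivlMr// -subr_ge0.
have -> : t^-1 * x ^+ 2 + t - `|x| * 2 = t^-1 * (`|x| - t) ^+ 2.
  by rewrite sqrrB real_normK ?num_real//; field; rewrite gt_eqF.
by rewrite mulr_ge0 ?sqr_ge0 ?invr_ge0 ?ltW.
Qed.

(** Weighing [x ^+ 2] by [2 ^+ k] in [normr_le_sqr_weight] shows that the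
    increments are summable in [L^1]. *)
Lemma ae_cvg_of_sqr_increments (w : nat -> T -> R) (c : R) :
  (forall k, measurable_fun setT (w k)) ->
  (forall k x, `|w k x| <= 1) -> 0 <= c ->
  (forall k, \int[mu]_x (w k.+1 x - w k x) ^+ 2 <= c / 4 ^+ k) ->
  \forall x \ae mu, cvgn (w ^~ x).
Proof.
move=> mw w1 c0 wc.
pose D k x := w k.+1 x - w k x.
have mD k : measurable_fun setT (D k) by exact: measurable_funB.
have D2 k x : `|D k x| <= 2.
  by rewrite (le_trans (ler_normB _ _))// (_ : 2 = 1 + 1)// lerD.
have iD k : mu.-integrable setT (EFin \o D k) by exact: (@integrable_bounded _ 2).
have iS k : mu.-integrable setT (EFin \o (fun x => D k x ^+ 2)).
  apply: (@integrable_bounded _ 4); first exact: measurable_funX.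
  move=> x; rewrite normrX (_ : 4 = 2 ^+ 2); last by rewrite -natrX.
  by rewrite lerXn2r ?nnegrE.
have ID k : \int[mu]_x `|D k x| <= (c + 1) / 2 / 2 ^+ k.
  have t0 : 0 < (2 ^+ k)^-1 :> R by rewrite invr_gt0 exprn_gt0.
  have i1 : mu.-integrable setT (EFin \o (fun x => 2 ^+ k * D k x ^+ 2)).
    by have := integrableZl measurableT (2 ^+ k) (iS k).
  have ic : mu.-integrable setT (EFin \o cst (2 ^+ k)^-1 : T -> \bar R).
    exact: finite_measure_integrable_cst.
  have i2 : mu.-integrable setT
      (EFin \o (fun x => 2 ^+ k * D k x ^+ 2 + (2 ^+ k)^-1)).
    by have := integrableD measurableT i1 ic.
  apply: (@le_trans _ _
      (\int[mu]_x (2^-1 * (2 ^+ k * D k x ^+ 2 + (2 ^+ k)^-1)))).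
    apply: le_Rintegral => //; first exact: integrable_norm.
      by have := integrableZl measurableT 2^-1 i2.
    move=> x _; have := normr_le_sqr_weight (D k x) t0.
    by rewrite invrK mulrC.
  rewrite RintegralZl// RintegralD//.
  rewrite RintegralZl// Rintegral_probability_cst.
  have -> : (c + 1) / 2 / 2 ^+ k = 2^-1 * (2 ^+ k * (c / 4 ^+ k) + (2 ^+ k)^-1).
    rewrite (_ : 4 = 2 * 2 :> R) ?exprMn; last by rewrite -natrM.
    have : (2 : R) ^+ k != 0 by rewrite expf_neq0.
    by move: (2 ^+ k) => t t0'; field.
  by rewrite ler_pM2l// lerD2r ler_pM2l ?exprn_gt0//; exact: wc.
have : \forall x \ae mu, cvgn (series (D ^~ x)).
  apply: ae_cvg_series_of_summable => //.
  pose r := c + 1.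
  apply: (@le_lt_trans _ _ (\sum_(k <oo) (r / (2 ^ (k + 1))%:R)%:E)%E).
    apply: lee_nneseries => [k _ _|k _]; first exact: integral_ge0.
    rewrite -[leLHS](EFin_Rintegral measurableT (integrable_norm (iD k))).
    rewrite lee_fin (le_trans (ID k))// /r natrX exprD expr1 invfM.
    by rewrite [_^-1 * _]mulrC mulrA.
  by have /cvg_lim -> // := @cvg_geometric_eseries_half R r 0; rewrite ltry.
apply: filterS => x cx.
have -> : w ^~ x = (fun k => w 0%N x + series (D ^~ x) k).
  by apply/funext => k; exact: (eq_sum_telescope (w ^~ x)).
by apply: is_cvgD => //; exact: is_cvg_cst.
Qed.

(** Since [shrink] vanishes only at infinity, convergence of [shrink \o v k] is
    convergence of [v k] to a possibly infinite limit, which Fatou's lemma shows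
    to be finite. *)
Lemma ae_cvg_of_shrink (v : nat -> T -> R) (M : R) :
  (forall k, mu.-integrable setT (EFin \o v k)) ->
  (forall k, \forall x \ae mu, 0 <= v k x) ->
  (forall k, \int[mu]_x v k x <= M) ->
  (\forall x \ae mu, cvgn (fun k => shrink (v k x))) ->
  exists h : T -> R, [/\ mu.-integrable setT (EFin \o h),
    (forall x, 0 <= h x) & \forall x \ae mu, v ^~ x @ \oo --> h x].
Proof.
move=> iv v0 vM sv.
have mv k := integrable_measurable (iv k).
have mE k : measurable_fun setT (fun x => `|v k x|%:E).
  by apply/measurable_EFinP; exact: measurableT_comp.
pose g x := limn_einf (fun k => `|v k x|%:E).
have mg : measurable_fun setT g.
  apply: measurableT_comp => //.
  apply: measurable_fun_limn_esup => k; exact: measurableT_comp (mE k).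
have g0 x : (0 <= g x)%E.
  rewrite /g limn_einf_lim; apply: lime_ge; first exact: is_cvg_einfs.
  by apply: nearW => n; apply: le_ereal_inf_tmp => _ [k _ <-]; rewrite lee_fin.
have ig : mu.-integrable setT g.
  apply/integrableP; split => //.
  under eq_integral do rewrite gee0_abs//.
  apply: (@le_lt_trans _ _ M%:E); last exact: ltry.
  apply: le_trans; first exact: fatou.
  rewrite limn_einf_lim; apply: lime_le; first exact: is_cvg_einfs.
  apply: nearW => n; apply: (@le_trans _ _ (\int[mu]_x `|v n x|%:E)%E).
    by apply: ereal_inf_lbound; exists n => /=.
  rewrite -(EFin_Rintegral measurableT (integrable_norm (iv n))) lee_fin.
  apply: le_trans (vM n); rewrite le_eqVlt; apply/orP; left; apply/eqP.
  apply: ae_eq_Rintegral => //; first exact: measurableT_comp.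
  by apply: filterS (v0 n) => x v0x _; rewrite /= ger0_norm.
exists (fine \o g); split.
- have mh : measurable_fun setT (fine \o g) by exact: measurableT_comp.
  apply/integrableP; split; first exact/measurable_EFinP.
  move/integrableP : ig => [_]; apply: le_lt_trans.
  apply: ge0_le_integral => //.
  + by apply: measurableT_comp => //; exact/measurable_EFinP.
  + exact: measurableT_comp.
  + move=> x _ /=; rewrite ger0_norm ?fine_ge0// gee0_abs//.
    by case: (g x) (g0 x) => [r| |]//=; rewrite leey.
- by move=> x /=; rewrite fine_ge0.
- have := integrable_ae measurableT ig; move/(ae_foralln) : v0; move: sv.
  apply: filterS3 => x /= cs v0x /(_ I) gfin.
  have vE k : v k x = (shrink (v k x))^-1 - 1.
    by rewrite invrK ger0_norm// addrC addKr.
  (* A zero limit would make [g x] infinite. *)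
  have lim0 : limn (fun k => shrink (v k x)) != 0.
    apply/eqP => l0; move: gfin; suff -> : g x = +oo%E by [].
    have sgt0 : \forall k \near \oo, 0 < shrink (v k x).
      by apply: nearW => k; exact: shrink_gt0.
    have /(cvgrVy sgt0)/cvgryPge inv : (fun k => shrink (v k x)) @ \oo --> 0.
      by rewrite -l0.
    have [-> _] // : (g x = +oo)%E * (limn_esup (fun k => `|v k x|%:E) = +oo)%E.
    apply: cvg_limn_einf_sup; apply/cvgeryP/cvgryPge => A.
    by apply: filterS (inv (A + 1)) => k /=; rewrite invrK; lra.
  have vl : v ^~ x @ \oo --> (limn (fun k => shrink (v k x)))^-1 - 1.
    under eq_fun do rewrite vE.
    by apply: cvgB; [exact: cvgV|exact: cvg_cst].
  suff -> : fine (g x) = (limn (fun k => shrink (v k x)))^-1 - 1 by [].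
  rewrite /g; under eq_fun do rewrite ger0_norm//.
  have /cvg_limn_einf_sup[-> //] : (fun k => (v k x)%:E) @ \oo -->
      ((limn (fun k => shrink (v k x)))^-1 - 1)%:E.
    by apply: cvg_EFin => //; exact: nearW.
Qed.

(** The infimum of [\int shrink v] over [C e] increases to a finite limit as [e]
    decreases to [0]. Choose [v k] with a value within [4 ^- k] of that limit, in
    some [C e] whose infimum is also within [4 ^- k] of it: the midpoint of two
    consecutive terms cannot do much better than they do, so uniform convexity
    forces [shrink \o v k] to be a fast Cauchy sequence in [L^2]. This replaces
    weak compactness for sets that are merely bounded in [L^1]. *)
Lemma ae_cvg_in_decreasing_midconvex (C : R -> set (T -> R)) (M : R) :
  (forall e, 0 < e -> C e !=set0) ->
  (forall e e', e <= e' -> C e `<=` C e') ->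
  (forall e v w, C e v -> C e w -> C e (fun x => (v x + w x) / 2)) ->
  (forall e v, C e v -> mu.-integrable setT (EFin \o v)) ->
  (forall e v, C e v -> \forall x \ae mu, 0 <= v x) ->
  (forall e v, C e v -> \int[mu]_x v x <= M) ->
  exists (v : nat -> T -> R) (h : T -> R),
    [/\ forall k, C (2 ^- k) (v k), mu.-integrable setT (EFin \o h),
        (forall x, 0 <= h x) & \forall x \ae mu, v ^~ x @ \oo --> h x].
Proof.
move=> C0 Cle Cmid Ci Cge0 CM.
pose J v := \int[mu]_x shrink (v x).
have J0 v : 0 <= J v.
  by apply: Rintegral_ge0 => x _; exact/ltW/shrink_gt0.
have J1 e v : C e v -> J v <= 1.
  move=> /Ci/integrable_measurable mv.
  rewrite -[leRHS]Rintegral_probability_cst; apply: le_Rintegral => //.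
  - exact: integrable_shrink.
  - exact: finite_measure_integrable_cst.
  - by move=> x _; exact: shrink_le1.
pose i e := inf [set J v | v in C e].
have lbJ e : has_lbound [set J v | v in C e].
  by exists 0 => _ [v _ <-].
have iJ e v : C e v -> i e <= J v by move=> Cv; apply: ge_inf => //; exists v.
pose S := [set i e | e in [set e : R | 0 < e]].
have hS : has_sup S.
  split; first by exists (i 1); exists 1 => //=.
  exists 1 => _ [e /= e0 <-]; have [v Cv] := C0 _ e0.
  exact: le_trans (iJ _ _ Cv) (J1 _ _ Cv).
have iS e : 0 < e -> i e <= sup S.
  by move=> e0; apply: ub_le_sup; [exact: hS.2|exists e].
have nice k : exists ev : R * (T -> R),
    [/\ 0 < ev.1 <= 2 ^- k, C ev.1 ev.2, sup S - 4 ^- k < i ev.1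
      & J ev.2 < sup S + 4 ^- k].
  have q0 : 0 < 4 ^- k :> R by rewrite invr_gt0 exprn_gt0.
  have p0 : 0 < 2 ^- k :> R by rewrite invr_gt0 exprn_gt0.
  have [_ [e /= e0 <-] ie] := sup_adherent q0 hS.
  pose e' := Num.min e (2 ^- k).
  have e'0 : 0 < e' by rewrite lt_min e0.
  have [v0 Cv0] := C0 _ e'0.
  have [|_ [v Cv <-] vi] := inf_adherent q0 (_ : has_inf [set J v | v in C e']).
    by split; [exists (J v0); exists v0|exact: lbJ].
  exists (e', v); split => //=.
  - by rewrite e'0 ge_min lexx orbT.
  - apply: lt_le_trans ie _; apply: lb_le_inf; first by exists (J v0); exists v0.
    move=> _ [w Cw <-]; apply: iJ; apply: Cle Cw.
    by rewrite ge_min lexx.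
  - by rewrite (lt_le_trans vi)// lerD2r iS.
have [ev evP] := choice nice.
pose v k := (ev k).2; pose e k := (ev k).1.
have Cv k : C (e k) (v k) by have [] := evP k.
have mv k : measurable_fun setT (v k).
  exact: integrable_measurable (Ci _ _ (Cv k)).
have mid k : sup S - 4 ^- k <= J (fun x => (v k.+1 x + v k x) / 2).
  have q : 4 ^- k.+1 <= 4 ^- k :> R.
    by rewrite lef_pV2 ?posrE ?exprn_gt0// ler_eXn2l// ltr1n.
  have [_ _ i1 _] := evP k; have [_ _ i2 _] := evP k.+1.
  (* The parameters need not be ordered: both terms lie in the larger set, whose
     infimum is that of one of the two. *)
  have /iJ : C (Num.max (e k) (e k.+1)) (fun x => (v k.+1 x + v k x) / 2).
    by apply: Cmid; apply: Cle (Cv _); rewrite le_max lexx ?orbT.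
  rewrite -/(e k) -/(e k.+1) in i1 i2.
  by case: (leP (e k) (e k.+1)) => _; lra.
(* [8 = 2 * (1 + 1 + 2)]: the factor of [shrink_midpoint], the errors of two
   consecutive terms, and that of the midpoint, which is counted twice. *)
have incr k : \int[mu]_x (shrink (v k.+1 x) - shrink (v k x)) ^+ 2 <= 8 / 4 ^+ k.
  have mm : measurable_fun setT (fun x => (v k.+1 x + v k x) / 2).
    by apply: measurable_funM => //; exact: measurable_funD.
  have i1 := integrable_shrink (mv k.+1); have i2 := integrable_shrink (mv k).
  have i3 := integrable_shrink mm.
  have i12 : mu.-integrable setT
      (EFin \o (fun x => shrink (v k.+1 x) + shrink (v k x))).
    exact: (integrableD measurableT i1 i2).
  have i23 : mu.-integrable setT
      (EFin \o (fun x => 2 * shrink ((v k.+1 x + v k x) / 2))).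
    exact: (integrableZl measurableT 2 i3).
  have i123 : mu.-integrable setT
      (EFin \o (fun x => shrink (v k.+1 x) + shrink (v k x) -
         2 * shrink ((v k.+1 x + v k x) / 2))).
    exact: (integrableB measurableT i12 i23).
  apply: (@le_trans _ _ (\int[mu]_x (2 * (shrink (v k.+1 x) + shrink (v k x) -
         2 * shrink ((v k.+1 x + v k x) / 2))))).
    apply: ae_le_Rintegral => //.
    - apply: (@integrable_bounded _ 1).
        apply: measurable_funX; apply: measurable_funB;
          exact: measurable_shrink.
      move=> x; rewrite normrX expr_le1// ler_norml.
      have := shrink_gt0 (v k x); have := shrink_gt0 (v k.+1 x).
      have := shrink_le1 (v k x); have := shrink_le1 (v k.+1 x).
      by move=> ? ? ? ?; apply/andP; split; lra.
    - exact: (integrableZl measurableT 2 i123).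
    - apply: filterS2 (Cge0 _ _ (Cv k)) (Cge0 _ _ (Cv k.+1)) => x ? ?.
      exact: shrink_midpoint.
  rewrite RintegralZl// RintegralB// RintegralD// RintegralZl//.
  have [_ _ _ J1'] := evP k; have [_ _ _ J2'] := evP k.+1.
  have := mid k; rewrite /J.
  have q : 4 ^- k.+1 <= 4 ^- k :> R.
    by rewrite lef_pV2 ?posrE ?exprn_gt0// ler_eXn2l// ltr1n.
  move: J1' J2'; rewrite /J -/(v k) -/(v k.+1); lra.
have cv : \forall x \ae mu, cvgn (fun k => shrink (v k x)).
  apply: (@ae_cvg_of_sqr_increments (fun k x => shrink (v k x)) 8) => //.
  - by move=> k; exact: measurable_shrink.
  - by move=> k x; rewrite gtr0_norm ?shrink_gt0// shrink_le1.
have [h [ih h0 vh]] := ae_cvg_of_shrink (fun k => Ci _ _ (Cv k))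
  (fun k => Cge0 _ _ (Cv k)) (fun k => CM _ _ (Cv k)) cv.
exists v, h; split => // k.
by have [/andP[_ ek] Cvk _ _] := evP k; exact: Cle Cvk.
Qed.

End forward_convexity.

(** * Integrals of classes of integrable functions *)

Section integrable_classes.
Context d (T : measurableType d) (R : realType) (m : probability T R).
Local Notation L1 := (LspaceType1 m).
Implicit Types (D : set T) (f g : L1).

Lemma L1_integrable f : m.-integrable setT (EFin \o f).
Proof. exact/Lfun1_integrable/Lspace_Lfun. Qed.

Lemma L1_measurable f : measurable_fun setT (f : T -> R).
Proof. exact/integrable_measurable/L1_integrable. Qed.

Lemma L1_class_of (u : T -> R) : m.-integrable setT (EFin \o u) ->
  exists f : L1, f = u %[ae m].
Proof.
move=> /Lfun1_integrable Lu.
exists (Lclass (Lfun_Sub (lexx 1%E) Lu)); exact: LclassK.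
Qed.

Lemma L1_integrableB f g :
  m.-integrable setT (EFin \o (fun x => f x - g x)).
Proof. exact: (integrableB measurableT (L1_integrable f) (L1_integrable g)). Qed.

Lemma L1_integrableD f g :
  m.-integrable setT (EFin \o (fun x => f x + g x)).
Proof. exact: (integrableD measurableT (L1_integrable f) (L1_integrable g)). Qed.

Lemma L1_integrableZ (a : R) f :
  m.-integrable setT (EFin \o (fun x => a * f x)).
Proof. exact: (integrableZl measurableT a (L1_integrable f)). Qed.

Lemma LspaceB_ae f g : (f - g)%R = (fun x => f x - g x) %[ae m].
Proof.
by apply: filterS2 (LspaceD_ae f (- g)) (LspaceN_ae g) => x /= h1 h2 _;
  rewrite h1// h2.
Qed.

Lemma L1_RintegralD D f g : measurable D ->
  \int[m]_(x in D) (f + g)%R x =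
  \int[m]_(x in D) f x + \int[m]_(x in D) g x.
Proof.
move=> mD; rewrite -RintegralD//; [|exact/integrable_setS/L1_integrable..].
apply: ae_eq_Rintegral => //; [exact: L1_measurable| |exact: LspaceD_ae].
exact/integrable_measurable/L1_integrableD.
Qed.

Lemma L1_RintegralB D f g : measurable D ->
  \int[m]_(x in D) (f - g)%R x =
  \int[m]_(x in D) f x - \int[m]_(x in D) g x.
Proof.
move=> mD; rewrite -RintegralB//; [|exact/integrable_setS/L1_integrable..].
apply: ae_eq_Rintegral => //; [exact: L1_measurable| |exact: LspaceB_ae].
exact/integrable_measurable/L1_integrableB.
Qed.

Lemma L1_Rintegral_normB f g :
  \int[m]_x `|f x - g x| = \int[m]_x `|(f - g)%R x|.
Proof.
apply: ae_eq_Rintegral => //.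
- exact/integrable_measurable/integrable_norm/L1_integrableB.
- exact/integrable_measurable/integrable_norm/L1_integrable.
- by apply: filterS (LspaceB_ae f g) => x /= ->.
Qed.

Lemma L1_RintegralZ D (a : R) f : measurable D ->
  \int[m]_(x in D) (a *: f)%R x = a * \int[m]_(x in D) f x.
Proof.
move=> mD; rewrite -RintegralZl//; [|exact/integrable_setS/L1_integrable..].
apply: ae_eq_Rintegral => //; [exact: L1_measurable| |exact: LspaceZ_ae].
exact/integrable_measurable/L1_integrableZ.
Qed.

Lemma L1_Rintegral_sum D (I : Type) (s : seq I) (F : I -> L1) : measurable D ->
  \int[m]_(x in D) (\sum_(i <- s) F i)%R x =
  \sum_(i <- s) \int[m]_(x in D) F i x.
Proof.
move=> mD; elim: s => [|i s IH]; last by rewrite !big_cons L1_RintegralD// IH.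
rewrite !big_nil -[0%R in LHS](scale0r (0 : L1)).
by rewrite L1_RintegralZ// mul0r.
Qed.

Lemma L1_Rintegral_setC D f : measurable D ->
  \int[m]_x f x = \int[m]_(x in D) f x + \int[m]_(x in ~` D) f x.
Proof.
move=> mD; rewrite -Rintegral_setU//; first by rewrite setUv.
- exact: measurableC.
- by rewrite setUv; exact: L1_integrable.
- by rewrite disj_set2E setICr.
Qed.

Lemma L1_indicT1 : \forall x \ae m, (L1_indicT m : T -> R) x = 1.
Proof.
by apply: filterS (L1_indicT_ae m) => x /= ->//; rewrite indicT.
Qed.

Lemma Rintegral_indicT : \int[m]_x L1_indicT m x = 1.
Proof.
rewrite -[RHS](Rintegral_probability_cst m); apply: ae_eq_Rintegral => //.
  exact: L1_measurable.
by apply: filterS L1_indicT1 => x ->.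
Qed.

End integrable_classes.

(** * Markov operators and almost everywhere limits *)

Section markov_operator_theory.
Context d (T : measurableType d) (R : realType) (m : probability T R).
Local Notation L1 := (LspaceType1 m).
Variable P : {linear L1 -> L1}.
Hypothesis hP : markov_operator P.
Implicit Types f g v : L1.

Lemma markov_le f g :
  (\forall x \ae m, f x <= g x) -> \forall x \ae m, P f x <= P g x.
Proof.
move=> fg.
have /(markov_positive hP) : \forall x \ae m, 0 <= (g - f)%R x.
  by apply: filterS2 fg (LspaceB_ae g f) => x ? -> //; rewrite subr_ge0.
rewrite linearB /=.
by apply: filterS2 (LspaceB_ae (P g) (P f)) => x -> //; rewrite subr_ge0.
Qed.

Lemma markov_Rintegral f : \int[m]_x P f x = \int[m]_x f x.
Proof. by rewrite /Rintegral (markov_integral hP). Qed.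

Lemma iter_markov_le n f g :
  (\forall x \ae m, f x <= g x) ->
  \forall x \ae m, iter n P f x <= iter n P g x.
Proof. by move=> fg; elim: n => //= n IH; exact: markov_le. Qed.

Lemma iter_markov_ge0 n f :
  (\forall x \ae m, 0 <= f x) -> \forall x \ae m, 0 <= iter n P f x.
Proof. by move=> f0; elim: n => //= n IH; exact: markov_positive. Qed.

Lemma iter_markov_Rintegral n f : \int[m]_x iter n P f x = \int[m]_x f x.
Proof. by elim: n => //= n IH; rewrite markov_Rintegral. Qed.

Lemma iter_markovZ n (a : R) f : iter n P (a *: f) = a *: iter n P f.
Proof. by elim: n => //= n ->; rewrite linearZ. Qed.

Lemma L1_indicT_ge0 : \forall x \ae m, 0 <= L1_indicT m x.
Proof. by apply: filterS (L1_indicT1 m) => x ->. Qed.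

(** First [P h <= h], a Fatou property of positive operators: in
    [P h <= P (v k) + P (h - min (v k) h)] the last term tends to [0] in [L^1] by
    dominated convergence, and so does [P (v k) - v k] by assumption. Then
    [P h = h], as both sides have the same integral. *)
Lemma markov_fixed_of_ae_limit (v : nat -> L1) (h : L1) :
  (forall k, \forall x \ae m, 0 <= v k x) -> (\forall x \ae m, 0 <= h x) ->
  (\forall x \ae m, (fun k => v k x) @ \oo --> h x) ->
  (fun k => \int[m]_x `|P (v k) x - v k x|) @ \oo --> (0 : R) ->
  P h = h.
Proof.
move=> v0 h0 vh Pv.
have mh := L1_measurable h; have mv k := L1_measurable (v k).
have ih := L1_integrable h.
have cmin (c : R) : continuous (fun a : R => Num.min a c).
  by move=> a; apply: continuous_min => //; exact: cvg_cst.
have /choice[mn mnE] : forall k, exists f : L1,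
    f = (fun x => Num.min (v k x) (h x)) %[ae m].
  by move=> k; apply: L1_class_of; apply: integrable_minr; exact: L1_integrable.
have Imn : (fun k => \int[m]_x (h - mn k)%R x) @ \oo --> (0 : R).
  have cI : (fun k => \int[m]_x mn k x) @ \oo --> \int[m]_x h x.
    apply: (dominated_cvg_Rintegral _ _ _ ih _).2 => //.
    - by move=> k; exact: L1_measurable.
    - apply: filterS2 vh (ae_foralln mnE) => x vhx mnx.
      have -> : (fun k => mn k x) = (fun k => Num.min (v k x) (h x)).
        by apply/funext => k; rewrite mnx.
      have := continuous_cvg _ (cmin (h x) _) vhx.
      by rewrite minxx; apply.
    - apply: filterS3 (ae_foralln v0) h0 (ae_foralln mnE) => x v0x h0x mnx k.
      by rewrite mnx// ger0_norm ?ge_min ?lexx ?orbT// le_min v0x h0x.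
  under eq_fun do rewrite L1_RintegralB//.
  by have := cvgB (cvg_cst (\int[m]_x h x)) cI; rewrite subrr; exact.
(* [v k - h] tends to [0] almost everywhere but perhaps not in [L^1]; cutting the
   comparison at height [1] restores convergence of the integrals. *)
pose cap (a : R) := Num.min (Num.max a 0) 1.
have mcap (u : T -> R) : measurable_fun setT u -> measurable_fun setT (cap \o u).
  by move=> mu; apply: measurable_minr => //; exact: measurable_maxr.
have capb a : 0 <= cap a <= 1.
  by rewrite le_min le_max lexx orbT ler01 ge_min lexx orbT.
have icap (u : T -> R) : measurable_fun setT u ->
    m.-integrable setT (EFin \o (cap \o u)).
  move=> mu; apply: (@integrable_bounded _ _ _ _ _ 1); first exact: mcap.
  by move=> x /=; have /andP[? ?] := capb (u x); rewrite ger0_norm.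
have mB f g : measurable_fun setT (fun x => f x - g x).
  exact/integrable_measurable/L1_integrableB.
have Icap : (fun k => \int[m]_x cap (v k x - h x)) @ \oo --> (0 : R).
  rewrite -(Rintegral_probability_cst m 0).
  apply: (dominated_cvg_Rintegral (g := cst 1) _ _ _ _ _).2 => //.
  - by move=> k; exact: mcap.
  - apply: filterS vh => x vhx.
    have -> : 0 = cap 0 :> R by rewrite /cap maxxx min_l.
    have ccap : {for 0, continuous cap}.
      apply: continuous_min; last exact: cvg_cst.
      by apply: continuous_max => //; exact: cvg_cst.
    have vh0 : (fun k => v k x - h x) @ \oo --> (0 : R).
      by have := cvgB vhx (cvg_cst (h x)); rewrite subrr; exact.
    by have := continuous_cvg _ ccap vh0; apply.
  - exact: finite_measure_integrable_cst.
  - by apply: aeW => x k; have /andP[? ?] := capb (v k x - h x); rewrite ger0_norm.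
have cap_le a b c e : a <= b + c + e -> 0 <= e -> cap a <= `|b| + e + cap c.
  move=> abce e0; have := ler_norm b; have := normr_ge0 b.
  rewrite /cap /Num.min /Num.max; do ! case: ifP; lra.
have Icap0 : \int[m]_x cap (P h x - h x) <= 0.
  have key k : \int[m]_x cap (P h x - h x) <=
      \int[m]_x `|P (v k) x - v k x| + \int[m]_x (h - mn k)%R x +
      \int[m]_x cap (v k x - h x).
    have i1 := integrable_norm (L1_integrableB (P (v k)) (v k)).
    have i2 := L1_integrable (P (h - mn k)).
    have i12 : m.-integrable setT (EFin \o
        (fun x => `|P (v k) x - v k x| + P (h - mn k) x)).
      exact: (integrableD measurableT i1 i2).
    have i3 := icap _ (mB (v k) h).
    rewrite -(markov_Rintegral (h - mn k)).
    rewrite -RintegralD// -RintegralD//.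
    apply: ae_le_Rintegral => //; first exact: icap.
      exact: (integrableD measurableT i12 i3).
    have le1 : \forall x \ae m, P (mn k) x <= P (v k) x.
      apply: markov_le; apply: filterS (mnE k) => x ->//.
      by rewrite ge_min lexx.
    have r0 : \forall x \ae m, 0 <= P (h - mn k) x.
      apply: (markov_positive hP).
      apply: filterS2 (mnE k) (LspaceB_ae h (mn k)) => x mnx -> //.
      by rewrite mnx// subr_ge0 ge_min lexx orbT.
    have := LspaceB_ae (P h) (P (mn k)); rewrite -linearB.
    move: le1 r0; apply: filterS3 => x le1 r0 eB.
    by apply: cap_le => //; rewrite eB//; lra.
  have cv : (fun k => \int[m]_x `|P (v k) x - v k x| + \int[m]_x (h - mn k)%R x +
      \int[m]_x cap (v k x - h x)) @ \oo --> (0 + 0 + 0 : R).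
    by apply: cvgD => //; exact: cvgD.
  rewrite !addr0 in cv.
  rewrite -(cvg_lim _ cv)//; apply: limr_ge; first by apply/cvg_ex; exists 0.
  by apply: nearW => k; exact: key.
have Phh : \forall x \ae m, P h x <= h x.
  have : cap \o (fun x => P h x - h x) = (fun=> 0) %[ae m].
    apply: Rintegral_le0_ae0 => //; first exact: icap.
    by apply: aeW => x; have /andP[] := capb (P h x - h x).
  apply: filterS => x /= /(_ I).
  by rewrite /cap /Num.min /Num.max; do ! case: ifP; lra.
have : (h - P h)%R = (fun=> 0) %[ae m].
  apply: Rintegral_le0_ae0; first exact: L1_integrable.
    by apply: filterS2 Phh (LspaceB_ae h (P h)) => x ? -> //; rewrite subr_ge0.
  by rewrite L1_RintegralB// markov_Rintegral subrr.
move=> hPh; apply/LspaceP; apply: filterS2 hPh (LspaceB_ae h (P h)) => x.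
by move=> /(_ I) -> /(_ I) /eqP; rewrite eq_sym subr_eq0 => /eqP.
Qed.

End markov_operator_theory.

(** * Invariant densities and the mass left outside small sets *)

Section invariant_density_criteria.
Context d (T : measurableType d) (R : realType) (m : probability T R).
Local Notation L1 := (LspaceType1 m).
Variable P : {linear L1 -> L1}.
Hypothesis hP : markov_operator P.

Let avg n : L1 := Defs.cesaro P n (L1_indicT m).

Let avg_ge0 n : \forall x \ae m, 0 <= avg n x.
Proof.
have s0 : \forall x \ae m,
    0 <= (\sum_(0 <= i < n) iter i P (L1_indicT m))%R x.
  elim/big_ind : _ => [|f g f0 g0|i _].
  - have := @Lspace0_ae _ _ _ m 1%E (lexx 1%E).
    by apply: filterS => x /(_ I) ->.
  - apply: filterS3 f0 g0 (LspaceD_ae f g) => x f0 g0 -> //=.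
    by rewrite addr_ge0.
  - apply: iter_markov_ge0 => //; exact: L1_indicT_ge0.
have zn := LspaceZ_ae n%:R^-1 (\sum_(0 <= i < n) iter i P (L1_indicT m))%R.
apply: filterS2 s0 zn => x s0x -> //=.
by rewrite mulr_ge0 ?invr_ge0.
Qed.

Let avg_Rintegral n : (0 < n)%N -> \int[m]_x avg n x = 1.
Proof.
move=> n0; rewrite /avg /Defs.cesaro L1_RintegralZ// L1_Rintegral_sum//.
under eq_bigr do rewrite iter_markov_Rintegral// Rintegral_indicT.
by rewrite big_const_nat iter_addr_0 subn0 mulVf// pnatr_eq0 -lt0n.
Qed.

(** The sum telescopes: [P (avg n) - avg n = (P^n 1 - 1) / n]. *)
Let avg_almost_invariant n : (0 < n)%N ->
  \int[m]_x `|P (avg n) x - avg n x| <= 2 / n%:R.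
Proof.
move=> n0; pose o := L1_indicT m; pose w := n%:R^-1 *: (iter n P o - o).
have uw : P (avg n) - avg n = w.
  rewrite /avg /Defs.cesaro linearZ /= -scalerBr linear_sum /= -sumrB.
  by rewrite telescope_sumr// => i.
rewrite L1_Rintegral_normB uw.
have -> : 2 / n%:R = \int[m]_x (n%:R^-1 *: (iter n P o + o))%R x.
  by rewrite L1_RintegralZ// L1_RintegralD// iter_markov_Rintegral//
    Rintegral_indicT mulrC.
apply: ae_le_Rintegral => //; [|exact: L1_integrable|].
  exact/integrable_norm/L1_integrable.
have o0 := L1_indicT_ge0 m.
have := LspaceZ_ae n%:R^-1 (iter n P o - o).
have := LspaceZ_ae n%:R^-1 (iter n P o + o).
have := LspaceB_ae (iter n P o) o; have := LspaceD_ae (iter n P o) o.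
move=> e1 e2 e3 e4.
apply: filterS2 (filterI o0 (iter_markov_ge0 hP n o0))
  (filterI (filterI e1 e2) (filterI e3 e4)).
move=> x [ox Px] [[/(_ I) e1x /(_ I) e2x] [/(_ I) e3x /(_ I) e4x]].
rewrite e3x e4x /= e1x e2x /= normrM ger0_norm ?invr_ge0//.
by rewrite ler_wpM2l ?invr_ge0// (le_trans (ler_normB _ _))// !ger0_norm.
Qed.

(** What the argument retains of the averages of large order: conditions stable
    under midpoints, which spare the construction of convex hulls. *)
Let near_density (e : R) : set L1 := [set v : L1 |
  [/\ \forall x \ae m, 0 <= v x, \int[m]_x v x = 1,
      \int[m]_x `|P v x - v x| <= e &
      forall A, measurable A ->
        ((\int[m]_(x in A) v x)%:E <= sup_averages P A)%E]].

Let near_density_nonempty e : 0 < e -> near_density e !=set0.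
Proof.
move=> e0; have [n n0 ne] : exists2 n, (0 < n)%N & 2 / n%:R <= e.
  exists (Num.truncn (2 / e)).+1 => //.
  rewrite ler_pdivrMr// mulrC -ler_pdivrMr//.
  exact/ltW/truncnS_gt.
exists (avg n); split.
- exact: avg_ge0.
- exact: avg_Rintegral.
- exact: le_trans (avg_almost_invariant n0) ne.
- move=> A mA; rewrite EFin_Rintegral//; last exact: L1_integrable.
  by apply: ereal_sup_ubound; exists n.
Qed.

Let near_density_le e e' : e <= e' -> near_density e `<=` near_density e'.
Proof.
by move=> ee v [? ? ve ?]; split => //; exact: le_trans ve ee.
Qed.

Let near_density_mid e v w : near_density e v -> near_density e w ->
  near_density e (2^-1 *: (v + w)).
Proof.
move=> [v0 v1 ve vA] [w0 w1 we wA].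
have mid_ae (f g : L1) : \forall x \ae m,
    (2^-1 *: (f + g))%R x = (f x + g x) / 2.
  apply: filterS2 (LspaceD_ae f g) (LspaceZ_ae 2^-1 (f + g)) => x h1 -> //=.
  by rewrite h1//= mulrC.
have mid_int A (f g : L1) : measurable A -> \int[m]_(x in A)
    (2^-1 *: (f + g))%R x =
    (\int[m]_(x in A) f x + \int[m]_(x in A) g x) / 2.
  by move=> mA; rewrite L1_RintegralZ// L1_RintegralD// mulrC.
split.
- apply: filterS3 v0 w0 (mid_ae v w) => x vx wx ->.
  by rewrite divr_ge0// addr_ge0.
- by rewrite mid_int// v1 w1; field.
- have iv := integrable_norm (L1_integrableB (P v) v).
  have iw := integrable_norm (L1_integrableB (P w) w).
  have ivw : m.-integrable setT
      (EFin \o (fun x => `|P v x - v x| + `|P w x - w x|)).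
    exact: (integrableD measurableT iv iw).
  apply: (@le_trans _ _
      (\int[m]_x (2^-1 * (`|P v x - v x| + `|P w x - w x|)))).
    apply: ae_le_Rintegral => //.
    + exact/integrable_norm/L1_integrableB.
    + exact: (integrableZl measurableT 2^-1 ivw).
    + have := mid_ae (P v) (P w); rewrite -linearD -linearZ.
      apply: filterS2 (mid_ae v w) => x -> ->.
      rewrite (_ : _ - _ = 2^-1 * ((P v x - v x) + (P w x - w x))); last by ring.
      by rewrite normrM ger0_norm// ler_wpM2l// ler_normD.
  by rewrite RintegralZl// RintegralD//; lra.
- move=> A mA; rewrite mid_int//.
  case: (sup_averages P A) (vA _ mA) (wA _ mA) => [r| |].
  - by rewrite !lee_fin; lra.
  - by move=> _ _; rewrite leey.
  - by move=> +; rewrite leeNy_eq.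
Qed.

(** If the limit vanished, Egorov's theorem would make the convergence uniform
    off a set of measure less than [delta], where the approximants keep a fixed
    amount of mass. *)
Let mass_of_limit (delta : R) (v : nat -> L1) (h : T -> R) :
  0 < delta ->
  (forall A, measurable A -> (m A < delta%:E)%E -> (sup_averages P A < 1)%E) ->
  (forall k, near_density (2 ^- k) (v k)) ->
  m.-integrable setT (EFin \o h) -> (forall x, 0 <= h x) ->
  (\forall x \ae m, (fun k => v k x) @ \oo --> h x) ->
  0 < \int[m]_x h x.
Proof.
move=> delta0 av vn ih h0 vh; rewrite ltNge; apply/negP => Ih.
have hz : h = (fun=> 0) %[ae m].
  by apply: Rintegral_le0_ae0 => //; exact: aeW.
have [B [mB Bdelta vB]] : exists B, [/\ measurable B, (m B < delta%:E)%E &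
    {uniform setT `\` B, (fun k => v k : T -> R) @ \oo --> (fun=> 0 : R)}].
  apply: ae_pointwise_almost_uniform => //.
  - by move=> n; exact: L1_measurable.
  - by rewrite (le_lt_trans (probability_le1 m _))// ltry.
  - by apply: filterS2 hz vh => x /(_ I) ->.
have sB k : ((\int[m]_(x in B) v k x)%:E <= sup_averages P B)%E.
  by have [_ _ _] := vn k; apply.
have := av _ mB Bdelta.
case E : (sup_averages P B) => [s| |]; last 2 first.
- by rewrite ltNge leey.
- by have := sB 0%N; rewrite E leeNy_eq.
rewrite lte_fin => s1.
pose eta := (1 - s) / 2.
have eta0 : 0 < eta by rewrite divr_gt0// subr_gt0.
have [k vk] : exists k, forall x, ~ B x -> `|v k x| < eta.
  have : nbhs ((fun=> 0 : R) : {uniform` (setT `\` B) -> R})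
      [set f : T -> R | forall x, ~ B x -> `|f x| < eta].
    apply/uniform_nbhs; exists [set xy : R * R | ball xy.1 eta xy.2].
    split; first exact: (entourage_ball _ (PosNum eta0)).
    move=> f /= fB x Bx; have := fB x (conj I Bx).
    by rewrite /ball /= sub0r normrN.
  by move=> /vB [k _ /(_ k (leqnn k))]; exists k.
have [v0 v1 _ _] := vn k.
have mC : measurable (~` B) by exact: measurableC.
have := L1_Rintegral_setC (v k) mB; rewrite v1.
have : \int[m]_(x in ~` B) v k x <= eta.
  apply: (@le_trans _ _ (\int[m]_(x in ~` B) eta)).
    apply: le_Rintegral => //.
    + exact/integrable_setS/L1_integrable.
    + exact: finite_measure_integrable_cst.
    + by move=> x Bx; rewrite ltW// (le_lt_trans (ler_norm _))// vk.
  rewrite Rintegral_cst// ler_piMr ?(ltW eta0)//.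
  have m1 : (m (~` B) <= 1%:E)%E by exact: probability_le1.
  by apply: (fine_le _ _ m1); rewrite // ge0_fin_numE// (le_lt_trans m1)// ltry.
have := sB k; rewrite E lee_fin /eta; lra.
Qed.

Lemma invariant_density_of_averages (delta : R) : 0 < delta ->
  (forall A, measurable A -> (m A < delta%:E)%E -> (sup_averages P A < 1)%E) ->
  exists h : L1, invariant_density P h.
Proof.
move=> delta0 av.
pose C e : set (T -> R) := [set f | measurable_fun setT f /\
  exists2 v : L1, v = f %[ae m] & near_density e v].
have Ci e f : C e f -> m.-integrable setT (EFin \o f).
  by move=> [mf [v vf _]]; apply: ae_eq_integrable vf _ => //;
    exact: L1_integrable.
(* [C] is [near_density] for functions instead of classes. *)
have [||||||f [h [fC ih h0 fh]]] := @ae_cvg_in_decreasing_midconvex _ _ _ m C 1.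
- move=> e /near_density_nonempty[v vn]; exists v; split.
    exact: L1_measurable.
  by exists v => //; exact: ae_eq_refl.
- move=> e e' ee f [mf [v vf vn]]; split => //; exists v => //.
  exact: near_density_le vn.
- move=> e f g [mf [v vf vn]] [mg [w wg wn]]; split.
    by apply: measurable_funM => //; exact: measurable_funD.
  exists (2^-1 *: (v + w)); last exact: near_density_mid.
  apply: filterS2 (filterI vf wg)
    (filterI (LspaceD_ae v w) (LspaceZ_ae 2^-1 (v + w))).
  move=> x [vx wx] [sx zx] _.
  by rewrite zx//= sx//= vx// wx// mulrC.
- exact: Ci.
- move=> e f [mf [v vf [v0 _ _ _]]].
  by apply: filterS2 vf v0 => x /(_ I) ->.
- move=> e f [mf [v vf [_ v1 _ _]]].
  rewrite -v1 le_eqVlt; apply/orP; left; apply/eqP.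
  by apply: ae_eq_Rintegral => //; [exact: L1_measurable|exact: ae_eq_sym].
have /choice[v vP] : forall k, exists v : L1,
    v = f k %[ae m] /\ near_density (2 ^- k) v.
  by move=> k; have [_ [v vf vn]] := fC k; exists v.
have vn k := (vP k).2.
have vh : \forall x \ae m, (fun k => v k x) @ \oo --> h x.
  apply: filterS2 fh (ae_foralln (fun k => (vP k).1)) => x fhx vf.
  by rewrite (_ : (fun k => v k x) = f ^~ x)//; apply/funext => k; rewrite vf.
have hmass := mass_of_limit delta0 av vn ih h0 vh.
have [H Hh] := L1_class_of ih.
have H0 : \forall x \ae m, 0 <= H x by apply: filterS Hh => x ->.
have IH : \int[m]_x H x = \int[m]_x h x.
  apply: ae_eq_Rintegral => //; first exact: L1_measurable.
  exact: integrable_measurable ih.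
have PH : P H = H.
  apply: (markov_fixed_of_ae_limit hP (v := v)) => //.
  - by move=> k; have [] := vn k.
  - by apply: filterS2 vh Hh => x vhx ->.
  - apply: (@squeeze_cvgr _ _ _ _ (cst 0) (fun k => 2 ^- k)).
    + apply: nearW => k; have [_ _ -> _] := vn k.
      by rewrite Rintegral_ge0.
    + exact: cvg_cst.
    + under eq_fun do rewrite -exprVn; apply: cvg_expr.
      by rewrite ger0_norm// invf_lt1// ltr1n.
exists ((\int[m]_x h x)^-1 *: H); split.
- apply: filterS2 H0 (LspaceZ_ae (\int[m]_x h x)^-1 H) => x Hx -> //=.
  by rewrite mulr_ge0// invr_ge0 ltW.
- rewrite -EFin_Rintegral//; last exact: L1_integrable.
  by rewrite L1_RintegralZ// IH mulVf// gt_eqF.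
- by rewrite linearZ /= PH.
Qed.

(** Cut [h] at a height [K] that keeps most of its mass. Since [min h K <= K],
    the functions [P^n 1] dominate [P^n (min h K) / K], which lies below [h / K]
    and keeps the mass of [min h K / K]: little of it fits in a set where [h] has
    small integral, so a fixed amount of the mass of [P^n 1] stays outside. *)
Lemma sup_powers_of_invariant_density (h : L1) : invariant_density P h ->
  exists alpha delta : R, [/\ 0 < alpha < 1, 0 < delta &
    forall A : set T, measurable A -> (m A < delta%:E)%E ->
      (sup_powers P A < alpha%:E)%E].
Proof.
move=> [h0 h1 Ph].
have ih := L1_integrable h; have mh := L1_measurable h.
have Ih : \int[m]_x h x = 1 by rewrite /Rintegral h1.
have icut (K : R) : m.-integrable setT (EFin \o (fun x => Num.min (h x) K)).
  by apply: integrable_minr => //; exact: finite_measure_integrable_cst.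
have [K K1 IN] : exists2 K : R, 1 <= K & 3 / 4 <= \int[m]_x Num.min (h x) K.
  have cvI : (fun n => \int[m]_x Num.min (h x) n.+1%:R) @ \oo -->
      \int[m]_x h x.
    apply: (dominated_cvg_Rintegral _ mh _ ih _).2.
    - by move=> n; exact: integrable_measurable (icut _).
    - apply: aeW => x; apply/cvgrPdist_lt => e e0.
      exists (Num.truncn (h x)) => // n /= nx.
      rewrite min_l ?subrr ?normr0// ltW// (lt_le_trans (truncnS_gt _))//.
      by rewrite ler_nat.
    - apply: filterS h0 => x hx n.
      by rewrite ger0_norm ?ge_min ?lexx// le_min hx ler0n.
  rewrite Ih in cvI.
  have : \forall n \near \oo, 3 / 4 < \int[m]_x Num.min (h x) n.+1%:R.
    by apply: (cvgr_gt 1 cvI); lra.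
  by move=> [N _ /(_ N (leqnn N))/ltW]; exists N.+1%:R => //; rewrite ler1n.
have K0 : 0 < K by exact: lt_le_trans K1.
have [c cE] := L1_class_of (icut K).
have Ic : 3 / 4 <= \int[m]_x c x.
  rewrite (ae_eq_Rintegral measurableT _ _ cE)//; first exact: L1_measurable.
  exact: integrable_measurable (icut K).
have c0 : \forall x \ae m, 0 <= c x.
  by apply: filterS2 h0 cE => x hx /(_ I) ->; rewrite le_min hx ltW.
have ch : \forall x \ae m, c x <= h x.
  by apply: filterS cE => x /(_ I) ->; rewrite ge_min lexx.
have cK : \forall x \ae m, c x <= K.
  by apply: filterS cE => x /(_ I) ->; rewrite ge_min lexx orbT.
pose o := L1_indicT m.
have cKo : \forall x \ae m, c x <= (K *: o)%R x.
  apply: filterS3 cK (L1_indicT1 m) (LspaceZ_ae K o) => x cx ox -> //=.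
  by rewrite ox -[leRHS]/(K * 1) mulr1.
have iter_h n : iter n P h = h by elim: n => //= n ->.
have V1 : 0 < K^-1 <= 1 by rewrite invr_gt0 K0 invf_le1.
exists (1 - K^-1 / 8), (K^-1 / 4); split.
- by case/andP: V1 => ? ?; apply/andP; split; lra.
- by case/andP: V1 => ? ?; lra.
move=> A mA mAd; apply: (@le_lt_trans _ _ (1 - K^-1 / 4)%:E); last first.
  by rewrite lte_fin; case/andP: V1 => ? ?; lra.
apply: ge_ereal_sup => _ [n _ <-].
rewrite -EFin_Rintegral//; last exact: L1_integrable.
rewrite lee_fin.
have mC : measurable (~` A) by exact: measurableC.
have hA : \int[m]_(x in A) h x <= 1 / 2.
  have hc0 : \forall x \ae m, 0 <= (h - c)%R x.
    by apply: filterS2 ch (LspaceB_ae h c) => x ? -> //; rewrite subr_ge0.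
  have := ae_Rintegral_ge0 mC (L1_integrable (h - c)) hc0.
  have := L1_Rintegral_setC (h - c) mA.
  rewrite L1_RintegralB// Ih L1_RintegralB//.
  suff : \int[m]_(x in A) c x <= 1 / 4 by lra.
  apply: (@le_trans _ _ (\int[m]_(x in A) K)).
    apply: ae_le_Rintegral => //; first exact: L1_integrable.
    exact: finite_measure_integrable_cst.
  rewrite Rintegral_cst//.
  have fmA : m A \is a fin_num.
    by rewrite ge0_fin_numE// (lt_le_trans mAd)// leey.
  move: mAd; rewrite -(fineK fmA) lte_fin /= => mAd.
  rewrite mulrC -ler_pdivlMr// mul1r; lra.
have PcA : \int[m]_(x in A) iter n P c x <= \int[m]_(x in A) h x.
  apply: ae_le_Rintegral => //; [exact: L1_integrable..|].
  by have := iter_markov_le hP n ch; rewrite iter_h.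
have PcC : K^-1 * \int[m]_(x in ~` A) iter n P c x
    <= \int[m]_(x in ~` A) iter n P o x.
  rewrite ler_pdivrMl// -L1_RintegralZ// -iter_markovZ.
  apply: ae_le_Rintegral => //; [exact: L1_integrable..|].
  exact: iter_markov_le.
have := L1_Rintegral_setC (iter n P c) mA.
have := L1_Rintegral_setC (iter n P o) mA.
rewrite !iter_markov_Rintegral// Rintegral_indicT => eo ec.
have : K^-1 * (1 / 4) <= K^-1 * \int[m]_(x in ~` A) iter n P c x.
  by rewrite ler_pM2l ?invr_gt0//; lra.
by rewrite -/o; lra.
Qed.

Lemma sup_averages_le_sup_powers (A : set T) : measurable A ->
  (sup_averages P A <= sup_powers P A)%E.
Proof.
move=> mA; apply: ge_ereal_sup => _ [n n0 <-].
have {}n0 : (0 < n)%N by exact: n0.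
rewrite -(EFin_Rintegral mA (L1_integrable _)).
rewrite /Defs.cesaro L1_RintegralZ// L1_Rintegral_sum//.
have pow i : ((\int[m]_(x in A) iter i P (L1_indicT m) x)%:E <= sup_powers P A)%E.
  rewrite (EFin_Rintegral mA (L1_integrable _)).
  by apply: ereal_sup_ubound; exists i.
case: (sup_powers P A) pow => [s| |] pow.
- rewrite lee_fin ler_pdivrMl ?ltr0n//.
  apply: (@le_trans _ _ (\sum_(0 <= i < n) s)).
    by apply: ler_sum => i _; rewrite -lee_fin.
  by rewrite big_const_nat iter_addr_0 subn0 mulr_natl.
- by rewrite leey.
- by have := pow 0%N; rewrite leeNy_eq.
Qed.

End invariant_density_criteria.

Theorem theorem5 (d : measure_display) (X : measurableType d) (R : realType)
    (m : probability X R) (P : {linear LspaceType1 m -> LspaceType1 m})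
    (hP : markov_operator P) :
  [<->
    (exists h : LspaceType1 m, invariant_density P h);
    (exists alpha delta : R, [/\ 0 < alpha < 1, 0 < delta &
       forall A : set X, measurable A -> (m A < delta%:E)%E ->
         (sup_powers P A < alpha%:E)%E]);
    (exists alpha delta : R, [/\ 0 < alpha < 1, 0 < delta &
       forall A : set X, measurable A -> (m A < delta%:E)%E ->
         (sup_averages P A < alpha%:E)%E])] /\
  [<->
    (exists h : LspaceType1 m, invariant_density P h);
    (exists2 delta : R, 0 < delta &
       forall A : set X, measurable A -> (m A < delta%:E)%E ->
         (sup_powers P A < 1)%E);
    (exists2 delta : R, 0 < delta &
       forall A : set X, measurable A -> (m A < delta%:E)%E ->
         (sup_averages P A < 1)%E)].
Proof.
split; tfae.
- by move=> [h]; exact: sup_powers_of_invariant_density.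
- move=> [alpha [delta [a01 d0 H]]]; exists alpha, delta; split => // A mA mAd.
  exact: le_lt_trans (sup_averages_le_sup_powers P mA) (H A mA mAd).
- move=> [alpha [delta [/andP[_ a1] d0 H]]].
  apply: (invariant_density_of_averages hP d0) => A mA mAd.
  by apply: lt_trans (H A mA mAd) _; rewrite lte_fin.
- move=> [h /(sup_powers_of_invariant_density hP)].
  move=> [alpha [delta [/andP[_ a1] d0 H]]]; exists delta => // A mA mAd.
  by apply: lt_trans (H A mA mAd) _; rewrite lte_fin.
- move=> [delta d0 H]; exists delta => // A mA mAd.
  exact: le_lt_trans (sup_averages_le_sup_powers P mA) (H A mA mAd).
- by move=> [delta d0 H]; exact: (invariant_density_of_averages hP d0).
Qed.
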